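(* The category $\iota(\mathcal{F})$ is a thick subcategory of $\mathcal{F}_{quad}$; that is, the full subcategory of $\mathcal{F}_{quad}$ on the functors isomorphic to $\iota(F)$ for some $F$ in $\mathcal{F}$ is closed under subobjects, quotients and extensions in $\mathcal{F}_{quad}$.
   Context: A quadratic space is a finite-dimensional $\mathbb{F}_2$-vector space with a quadratic form $q$, with associated bilinear form $B(x,y)=q(x+y)+q(x)+q(y)$; it is nondegenerate if $B$ is. $\mathcal{E}$ (resp. $\mathcal{E}^f$) is the category of all (resp. finite-dimensional) $\mathbb{F}_2$-vector spaces. $\bot$ denotes orthogonal sum. $\mathcal{E}_q$: nondegenerate quadratic spaces with linear maps preserving the quadratic forms (these are injective). $\mathcal{T}_q$: same objects as $\mathcal{E}_q$; $\mathrm{Hom}_{\mathcal{T}_q}(V,W)$ is the set of equivalence classes $[V\xrightarrow{f}X\xleftarrow{g}W]$ of diagrams in $\mathcal{E}_q$, for the equivalence relation generated by: $(f,g)$ is related to $(\alpha f,\alpha g)$ for every morphism $\alpha:X\to X'$ of $\mathcal{E}_q$. Every morphism has a representative $[V\xrightarrow{f}W\bot W'\xleftarrow{i_W}W]$ with $i_W$ the canonical inclusion; composition is $[W\xrightarrow{\varphi}Z\bot L\leftarrow Z]\circ[V\xrightarrow{f}W\bot W'\leftarrow W]=[V\xrightarrow{(\varphi\bot\mathrm{Id})f}Z\bot L\bot W'\leftarrow Z]$. $\mathcal{F}_{quad}$ is the category of functors $\mathcal{T}_q\to\mathcal{E}$, and $\mathcal{F}$ is the category of functors $\mathcal{E}^f\to\mathcal{E}$.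 The functor $\epsilon:\mathcal{T}_q\to\mathcal{E}^f$ sends a quadratic space to its underlying vector space and $[V\xrightarrow{f}W\bot W'\xleftarrow{i_W}W]$ to $p_W\circ f$, with $p_W$ the orthogonal projection onto $W$. $\iota:\mathcal{F}\to\mathcal{F}_{quad}$ is precomposition with $\epsilon$; it is exact and fully faithful. *)

(* Defs.v *)
From HB Require Import structures.
From Stdlib Require Import Relations.
From mathcomp Require Import all_boot all_order all_algebra boolp.

Set Implicit Arguments.
Unset Strict Implicit.
Unset Printing Implicit Defensive.

Import GRing.Theory.
Local Open Scope ring_scope.

Record category := Category {
  ob :> Type;
  hom : ob -> ob -> Type;
  idc : forall x, hom x x;
  comp : forall x y z, hom y z -> hom x y -> hom x z;
  comp_idl : forall x y (f : hom x y), comp (idc y) f = f;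
  comp_idr : forall x y (f : hom x y), comp f (idc x) = f;
  comp_assoc : forall x y z t (h : hom z t) (g : hom y z) (f : hom x y),
    comp h (comp g f) = comp (comp h g) f }.

Arguments hom {_} _ _.
Arguments idc {_} _.
Arguments comp {_ _ _ _} _ _.

Record functor (C D : category) := Functor {
  fob :> C -> D;
  fmap : forall x y : C, hom x y -> hom (fob x) (fob y);
  fmap_id : forall x, fmap (idc x) = idc (fob x);
  fmap_comp : forall x y z (g : hom y z) (f : hom x y),
    fmap (comp g f) = comp (fmap g) (fmap f) }.

Arguments fmap {C D} _ {x y} _.

Record nattrans (C D : category) (F G : functor C D) := NatTrans {
  nt :> forall x : C, hom (F x) (G x);
  nt_natural : forall (x y : C) (f : hom x y),
    comp (nt y) (fmap F f) = comp (fmap G f) (nt x) }.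

Section FunctorCategory.
Variables C D : category.

Lemma nattrans_eq (F G : functor C D) (a b : nattrans F G) :
  (forall x, a x = b x) -> a = b.
Proof.
case: a b => [a na] [b nb] /= eab.
have {}eab : a = b by exact: functional_extensionality_dep eab.
by subst b; rewrite (Prop_irrelevance na nb).
Qed.

Definition nt_id (F : functor C D) : nattrans F F.
Proof.
by exists (fun x => idc (F x)) => x y f; rewrite comp_idl comp_idr.
Defined.

Definition nt_comp (F G H : functor C D) (b : nattrans G H) (a : nattrans F G) :
  nattrans F H.
Proof.
exists (fun x => comp (b x) (a x)) => x y f.
by rewrite -comp_assoc nt_natural !comp_assoc nt_natural.
Defined.

Definition functor_cat : category.
Proof.
apply: (@Category (functor C D) (@nattrans C D) nt_id nt_comp).
- by move=> F G a; apply: nattrans_eq => x; exact: comp_idl.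
- by move=> F G a; apply: nattrans_eq => x; exact: comp_idr.
- by move=> F G H K c b a; apply: nattrans_eq => x; exact: comp_assoc.
Defined.

End FunctorCategory.

Definition functor_comp (C D E : category) (F : functor D E) (K : functor C D) :
  functor C E.
Proof.
exists (fun x => F (K x)) (fun x y f => fmap F (fmap K f)).
- by move=> x; rewrite !fmap_id.
- by move=> x y z g f; rewrite !fmap_comp.
Defined.

Definition whisker (C D E : category) (K : functor C D) (F G : functor D E)
  (a : nattrans F G) : nattrans (functor_comp F K) (functor_comp G K).
Proof. by exists (fun x => a (K x)) => x y f; exact: (nt_natural a). Defined.

Definition precomposition (C D E : category) (K : functor C D) :
  functor (functor_cat D E) (functor_cat C E).
Proof.
exists (fun F : functor_cat D E => functor_comp F K : functor_cat C E)
       (fun F G a => whisker K a).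
- by move=> F; exact: nattrans_eq.
- by move=> F G H b a; exact: nattrans_eq.
Defined.

Section CategoricalNotions.
Variable C : category.

Definition isomorphic (x y : C) :=
  exists (f : hom x y) (g : hom y x), comp g f = idc x /\ comp f g = idc y.

Definition mono (x y : C) (f : hom x y) :=
  forall z (g h : hom z x), comp f g = comp f h -> g = h.

Definition epi (x y : C) (f : hom x y) :=
  forall z (g h : hom y z), comp g f = comp h f -> g = h.

(* Zero morphisms are those factoring through a zero object; kernels,
   cokernels and short exact sequences are relative to them. *)
Definition zero_object (z : C) :=
  (forall x, exists! f : hom x z, True) /\ (forall x, exists! f : hom z x, True).

Definition zero_morphism (x y : C) (f : hom x y) :=
  exists (z : C) (g : hom x z) (h : hom z y), zero_object z /\ f = comp h g.

Definition is_kernel (x y z : C) (i : hom x y) (p : hom y z) :=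
  zero_morphism (comp p i) /\
  forall t (h : hom t y), zero_morphism (comp p h) ->
    exists! u : hom t x, comp i u = h.

Definition is_cokernel (x y z : C) (i : hom x y) (p : hom y z) :=
  zero_morphism (comp p i) /\
  forall t (h : hom y t), zero_morphism (comp h i) ->
    exists! u : hom z t, comp u p = h.

Definition short_exact (x y z : C) (i : hom x y) (p : hom y z) :=
  is_kernel i p /\ is_cokernel i p.

Definition thick (P : C -> Prop) :=
  [/\ forall (x y : C) (i : hom x y), mono i -> P y -> P x,
      forall (x y : C) (p : hom x y), epi p -> P x -> P y
    & forall (x y z : C) (i : hom x y) (p : hom y z),
        short_exact i p -> P x -> P z -> P y].

End CategoricalNotions.

Definition ess_image (C D : category) (K : functor C D) (y : D) :=
  exists x : C, isomorphic (K x) y.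

Lemma linear_eq (R : pzRingType) (U V : lmodType R) (f g : {linear U -> V}) :
  f =1 g -> f = g.
Proof.
case: f g => f [[f1] [f2]] [g [[g1] [g2]]] /= efg.
have {}efg : f = g by exact: funext.
by subst g; rewrite (Prop_irrelevance f1 g1) (Prop_irrelevance f2 g2).
Qed.

Definition lin_id (R : pzRingType) (U : lmodType R) : {linear U -> U} := idfun.
Definition lin_comp (R : pzRingType) (U V W : lmodType R)
  (g : {linear V -> W}) (f : {linear U -> V}) : {linear U -> W} := g \o f.

Definition Vec : category.
Proof.
apply: (@Category (lmodType 'F_2) (fun U V => {linear U -> V})
  (@lin_id _) (@lin_comp _)).
- by move=> U V f; exact: linear_eq.
- by move=> U V f; exact: linear_eq.
- by move=> U V W X h g f; exact: linear_eq.
Defined.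

Definition FinVec : category.
Proof.
apply: (@Category (vectType 'F_2) (fun U V => {linear U -> V})
  (fun U => lin_id U) (fun U V W g f => lin_comp g f)).
- by move=> U V f; exact: linear_eq.
- by move=> U V f; exact: linear_eq.
- by move=> U V W X h g f; exact: linear_eq.
Defined.

Definition polar (V : lmodType 'F_2) (q : V -> 'F_2) (x y : V) : 'F_2 :=
  q (x + y) + q x + q y.

Record quadSpace := QuadSpace {
  qcar :> vectType 'F_2;
  qform : qcar -> 'F_2;
  qform_homog : forall a x, qform (a *: x) = a ^+ 2 * qform x;
  qform_bilin : bilinear_for *%R *%R (polar qform);
  qform_nondeg : forall x, (forall y, polar qform x y = 0) -> x = 0 }.

Arguments qform {_} _.

Definition qB (V : quadSpace) (x y : V) : 'F_2 := polar qform x y.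

Section QuadraticSpaceTheory.
Variable V : quadSpace.
Implicit Types x y z : V.

Lemma F2_add_self (a : 'F_2) : a + a = 0.
Proof. by rewrite addrr_pchar2 // pchar_Fp. Qed.

Lemma qB_addl x y z : qB (x + y) z = qB x z + qB y z.
Proof. by have := (qform_bilin V).1 z 1 x y; rewrite /= scale1r mul1r. Qed.

Lemma qBC x y : qB x y = qB y x.
Proof. by rewrite /qB /polar (addrC x) addrAC. Qed.

Lemma qB_scalel a x y : qB (a *: x) y = a * qB x y.
Proof.
have e0 : qB 0 y = 0 by have := qB_addl 0 0 y; rewrite addr0 F2_add_self.
have /= := (qform_bilin V).1 y a x 0.
by rewrite addr0 -!/(qB _ _) e0 addr0.
Qed.

Lemma qB_addr x y z : qB x (y + z) = qB x y + qB x z.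
Proof. by rewrite !(qBC x) qB_addl. Qed.

Lemma qB_scaler a x y : qB x (a *: y) = a * qB x y.
Proof. by rewrite !(qBC x) qB_scalel. Qed.

Lemma qB0l y : qB (0 : V) y = 0.
Proof. by rewrite -(scale0r 0) qB_scalel mul0r. Qed.

Lemma qB0r x : qB x 0 = 0.
Proof. by rewrite qBC qB0l. Qed.

Lemma qB_subl x y z : qB (x - y) z = qB x z - qB y z.
Proof. by rewrite qB_addl -scaleN1r qB_scalel mulN1r. Qed.

Lemma qform0 : qform (0 : V) = 0.
Proof. by rewrite -(scale0r 0) qform_homog expr0n mul0r. Qed.

Lemma qformD x y : qform (x + y) = qform x + qform y + qB x y.
Proof.
rewrite /qB /polar -[qform (x + y) + _ + _]addrA [_ + (_ + (_ + _))]addrC.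
by rewrite -addrA F2_add_self addr0.
Qed.

Lemma qB_nondeg x : (forall y, qB x y = 0) -> x = 0.
Proof. exact: qform_nondeg. Qed.

Lemma qB_inj x x' : (forall y, qB x y = qB x' y) -> x = x'.
Proof.
move=> e; apply/eqP; rewrite -subr_eq0; apply/eqP; apply: qB_nondeg => y.
by rewrite qB_subl e subrr.
Qed.

Definition qB_row x : 'rV['F_2]_(\dim {:V}) := \row_i qB x (vbasis {:V})`_i.

Lemma qB_row_linear : linear qB_row.
Proof. by move=> a x y; apply/rowP => i; rewrite !mxE qB_addl qB_scalel. Qed.

HB.instance Definition _ :=
  GRing.isLinear.Build 'F_2 V 'rV['F_2]_(\dim {:V}) _ qB_row qB_row_linear.

Lemma qB_represent (phi : V -> 'F_2) : scalar phi ->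
  exists x, forall y, qB x y = phi y.
Proof.
move=> lphi.
have phi0 : phi 0 = 0.
  by have := lphi 1 0 0; rewrite /= scale1r addr0 mul1r F2_add_self.
have phiD y z : phi (y + z) = phi y + phi z.
  by have := lphi 1 y z; rewrite /= scale1r mul1r.
have phiZ a y : phi (a *: y) = a * phi y.
  by have := lphi a y 0; rewrite /= phi0 !addr0.
have ext x : (forall i : 'I_(\dim {:V}), qB x (vbasis {:V})`_i = phi (vbasis {:V})`_i) ->
    forall y, qB x y = phi y.
  move=> e y; rewrite (coord_vbasis (memvf y)).
  apply: (big_ind (fun y => qB x y = phi y)); first by rewrite qB0r phi0.
  - by move=> u v eu ev; rewrite qB_addr eu ev phiD.
  - by move=> i _; rewrite qB_scaler e phiZ.
pose F : 'Hom(V, 'rV['F_2]_(\dim {:V})) := linfun qB_row.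
have FE x i : F x 0 i = qB x (vbasis {:V})`_i by rewrite lfunE mxE.
have kerF : lker F == 0%VS.
  apply/lker0P => x x' eF; apply: qB_inj => y; rewrite (coord_vbasis (memvf y)).
  apply: (big_ind (fun y => qB x y = qB x' y)); first by rewrite !qB0r.
  - by move=> u v eu ev; rewrite !qB_addr eu ev.
  - by move=> i _; rewrite !qB_scaler -!FE eF.
have imF : limg F = fullv.
  apply/eqP; rewrite eqEdim subvf limg_dim_eq; last first.
    by rewrite (eqP kerF) capv0.
  by rewrite (dimvf 'rV_(\dim {:V})) /dim /= mul1n leqnn.
have /memv_imgP[x _ ex] : \row_i phi (vbasis {:V})`_i \in limg F.
  by rewrite imF memvf.
by exists x; apply: ext => i; rewrite -FE -ex mxE.
Qed.

End QuadraticSpaceTheory.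

Record qmor (V W : quadSpace) := QMor {
  qlin :> {linear V -> W};
  qlin_q : forall x, qform (qlin x) = qform x }.

Lemma qmor_eq V W (f g : qmor V W) : f =1 g -> f = g.
Proof.
case: f g => [f hf] [g hg] /= efg.
have {}efg : f = g by exact: linear_eq.
by subst g; rewrite (Prop_irrelevance hf hg).
Qed.

Lemma qlin_B V W (f : qmor V W) x y : qB (f x) (f y) = qB x y.
Proof. by rewrite /qB /polar -!linearD !qlin_q. Qed.

Definition qid V : qmor V V := @QMor V V (lin_id V) (fun x => erefl).

Definition qcomp V W X (g : qmor W X) (f : qmor V W) : qmor V X :=
  @QMor V X (lin_comp g f) (fun x => etrans (qlin_q g (f x)) (qlin_q f x)).

Section OrthogonalSum.
Variables V W : quadSpace.

Definition osum_form (x : (V * W)%type) : 'F_2 := qform x.1 + qform x.2.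

Lemma osum_polar x y : polar osum_form x y = qB x.1 y.1 + qB x.2 y.2.
Proof.
rewrite /polar /osum_form /qB /polar /=.
by rewrite [X in X + (qform y.1 + _)]addrACA (addrACA (_ + _)).
Qed.

Lemma osum_homog a x : osum_form (a *: x) = a ^+ 2 * osum_form x.
Proof. by rewrite /osum_form !qform_homog mulrDr. Qed.

Lemma osum_bilin : bilinear_for *%R *%R (polar osum_form).
Proof.
split=> z a x y; rewrite !osum_polar /=.
- by rewrite !qB_addl !qB_scalel [in RHS]mulrDr addrACA.
- by rewrite !qB_addr !qB_scaler [in RHS]mulrDr addrACA.
Qed.

Lemma osum_nondeg x : (forall y, polar osum_form x y = 0) -> x = 0.
Proof.
move=> x0; rewrite [x]surjective_pairing; congr (_, _); apply: qB_nondeg => y.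
- by have := x0 (y, 0); rewrite osum_polar qB0r addr0.
- by have := x0 (0, y); rewrite osum_polar qB0r add0r.
Qed.

Definition osum : quadSpace := QuadSpace osum_homog osum_bilin osum_nondeg.

Definition oinl_fun (v : V) : osum := (v, 0).
Lemma oinl_linear : linear oinl_fun.
Proof. by move=> a x y; congr (_, _); rewrite /= scaler0 addr0. Qed.
HB.instance Definition _ :=
  GRing.isLinear.Build 'F_2 V osum _ oinl_fun oinl_linear.
Lemma oinl_q v : qform (oinl_fun v) = qform v.
Proof. by rewrite /= /osum_form qform0 addr0. Qed.

Definition oinl : qmor V osum := QMor oinl_q.

Definition oprl : {linear osum -> V} := fst.

End OrthogonalSum.

Section OrthogonalSumMorphism.
Variables (V V' W W' : quadSpace) (f : qmor V W) (f' : qmor V' W').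

Definition osum_fun (x : osum V V') : osum W W' := (f x.1, f' x.2).
Lemma osum_fun_linear : linear osum_fun.
Proof. by move=> a x y; congr (_, _); rewrite /= linearP. Qed.
HB.instance Definition _ :=
  GRing.isLinear.Build 'F_2 (osum V V') (osum W W') _ osum_fun osum_fun_linear.
Lemma osum_fun_q x : qform (osum_fun x) = qform x.
Proof. by rewrite /= /osum_form !qlin_q. Qed.

Definition osum_mor : qmor (osum V V') (osum W W') := QMor osum_fun_q.

End OrthogonalSumMorphism.

Section OrthogonalProjection.
Variables (W X : quadSpace) (g : qmor W X).

Lemma oproj_subproof x : exists w : W, forall w', qB w w' = qB x (g w').
Proof.
apply: (@qB_represent W (fun w' => qB x (g w'))) => a y z.
by rewrite linearP qB_addr qB_scaler.
Qed.

Definition oproj_fun (x : X) : W := projT1 (cid (oproj_subproof x)).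

Lemma oprojE x w : qB (oproj_fun x) w = qB x (g w).
Proof. exact: (projT2 (cid (oproj_subproof x)) w). Qed.

Lemma oproj_linear : linear oproj_fun.
Proof.
move=> a x y; apply: qB_inj => w.
by rewrite qB_addl qB_scalel !oprojE qB_addl qB_scalel.
Qed.
HB.instance Definition _ :=
  GRing.isLinear.Build 'F_2 X W _ oproj_fun oproj_linear.

(* For g : W -> X, the coordinate in W of the orthogonal projection of X onto
   g(W): oproj x is the w such that x - g w is orthogonal to g(W). *)
Definition oproj : {linear X -> W} := oproj_fun.

Lemma oprojK w : oproj (g w) = w.
Proof. by apply: qB_inj => y; rewrite oprojE qlin_B. Qed.

Lemma oproj_uniq x w : (forall w', qB w w' = qB x (g w')) -> oproj x = w.
Proof. by move=> e; apply: qB_inj => y; rewrite oprojE e. Qed.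

(* The orthogonal complement of g(W) in X. *)
Definition ocompl_space : {vspace X} := lker (linfun oproj).

Lemma ocompl_spaceP x :
  reflect (forall w, qB x (g w) = 0) (x \in ocompl_space).
Proof.
rewrite memv_ker lfunE; apply: (iffP eqP) => [x0 w|x0].
- by rewrite -oprojE [oproj_fun x]x0 qB0l.
- by apply: oproj_uniq => w; rewrite qB0l x0.
Qed.

Lemma ocompl_sub x : x - g (oproj x) \in ocompl_space.
Proof. by apply/ocompl_spaceP => w; rewrite qB_subl qlin_B oprojE subrr. Qed.

Definition ocompl_form (x : subvs_of ocompl_space) : 'F_2 := qform (vsval x).

Lemma ocompl_polar x y : polar ocompl_form x y = qB (vsval x) (vsval y).
Proof. by rewrite /polar /ocompl_form linearD. Qed.

Lemma ocompl_homog a x : ocompl_form (a *: x) = a ^+ 2 * ocompl_form x.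
Proof. by rewrite /ocompl_form linearZ qform_homog. Qed.

Lemma ocompl_bilin : bilinear_for *%R *%R (polar ocompl_form).
Proof.
split=> z a x y /=; rewrite !ocompl_polar linearP.
- by rewrite qB_addl qB_scalel.
- by rewrite qB_addr qB_scaler.
Qed.

Lemma ocompl_nondeg x : (forall y, polar ocompl_form x y = 0) -> x = 0.
Proof.
move=> x0; apply: val_inj; rewrite -[val 0]/(vsval 0) linear0; apply: qB_nondeg => y.
rewrite -(subrK (g (oproj y)) y) qB_addr.
rewrite (ocompl_spaceP _ (valP x)) addr0.
by have := x0 (vsproj _ (y - g (oproj y))); rewrite ocompl_polar vsprojK ?ocompl_sub.
Qed.

Definition ocompl : quadSpace :=
  QuadSpace ocompl_homog ocompl_bilin ocompl_nondeg.

Definition osplit_fun (x : X) : osum W ocompl :=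
  (oproj x, vsproj ocompl_space (x - g (oproj x))).
Lemma osplit_linear : linear osplit_fun.
Proof.
move=> a x y; congr (_, _); first by rewrite linearP.
have -> : a *: x + y - g (oproj (a *: x + y)) =
    a *: (x - g (oproj x)) + (y - g (oproj y)).
  by rewrite (linearP oproj) (linearP g) scalerBr opprD addrACA.
by rewrite linearP.
Qed.
HB.instance Definition _ :=
  GRing.isLinear.Build 'F_2 X (osum W ocompl) _ osplit_fun osplit_linear.
Lemma osplit_q x : qform (osplit_fun x) = qform x.
Proof.
rewrite /= /osum_form /= /ocompl_form vsprojK ?ocompl_sub //.
have -> : qform x = qform (x - g (oproj x) + g (oproj x)) by rewrite subrK.
rewrite [in RHS]qformD qlin_q.
by rewrite (ocompl_spaceP _ (ocompl_sub x)) addr0 addrC.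
Qed.

(* The isometry between X and the orthogonal sum of W with the orthogonal
   complement of g(W) in X. *)
Definition osplit : qmor X (osum W ocompl) := QMor osplit_q.

End OrthogonalProjection.

Lemma oproj_qcomp W X X' (g : qmor W X) (a : qmor X X') x :
  oproj (qcomp a g) (a x) = oproj g x.
Proof. by apply: oproj_uniq => w; rewrite oprojE /= qlin_B. Qed.

Lemma oproj_oinl W W' : oproj (oinl W W') =1 oprl W W'.
Proof.
move=> x; apply: oproj_uniq => w.
by rewrite /qB [RHS]osum_polar qB0r addr0.
Qed.

Record cospan (V W : quadSpace) := Cospan {
  apex : quadSpace;
  legl : qmor V apex;
  legr : qmor W apex }.

Arguments Cospan {V W apex} _ _.

Definition cospan_step V W (c d : cospan V W) : Prop :=
  exists a : qmor (apex c) (apex d),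
    legl d = qcomp a (legl c) /\ legr d = qcomp a (legr c).

Definition cospan_equiv V W : relation (cospan V W) :=
  clos_refl_sym_trans (cospan V W) (@cospan_step V W).

(* The set of equivalence classes, a class being a predicate on cospans. *)
Definition Tq_hom (V W : quadSpace) : Type :=
  {P : cospan V W -> Prop | exists c, P = cospan_equiv c}.

Definition Tq_class V W (c : cospan V W) : Tq_hom V W :=
  exist _ (cospan_equiv c) (ex_intro _ c erefl).

Definition Tq_repr V W (t : Tq_hom V W) : cospan V W :=
  projT1 (cid (proj2_sig t)).

Lemma Tq_hom_eq V W (s t : Tq_hom V W) : proj1_sig s = proj1_sig t -> s = t.
Proof.
by case: s t => [P hP] [Q hQ] /= e; subst Q; rewrite (Prop_irrelevance hP hQ).
Qed.

Lemma Tq_reprK V W (t : Tq_hom V W) : Tq_class (Tq_repr t) = t.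
Proof.
apply: Tq_hom_eq; exact: esym (projT2 (cid (proj2_sig t))).
Qed.

Lemma Tq_classP V W (c d : cospan V W) :
  Tq_class c = Tq_class d <-> cospan_equiv c d.
Proof.
split=> [[->]|cd]; first exact: rst_refl.
apply: Tq_hom_eq => /=; apply: funext => e; apply/propext; split=> h.
- by apply: rst_trans h; apply: rst_sym.
- exact: rst_trans h.
Qed.

Lemma Tq_class_step V W X X' (f : qmor V X) (g : qmor W X) (a : qmor X X')
    (f' : qmor V X') (g' : qmor W X') :
  f' =1 a \o f -> g' =1 a \o g ->
  Tq_class (Cospan f g) = Tq_class (Cospan f' g').
Proof.
move=> ef eg; apply/Tq_classP/rst_step; exists a.
by split; apply: qmor_eq.
Qed.

Lemma Tq_ind V W T (F : cospan V W -> T) :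
  (forall X X' (f : qmor V X) (g : qmor W X) (a : qmor X X'),
     F (Cospan f g) = F (Cospan (qcomp a f) (qcomp a g))) ->
  forall c d, Tq_class c = Tq_class d -> F c = F d.
Proof.
move=> stepF c d /Tq_classP; elim=> {c d} [c d|//|c d _ -> //|c d e _ -> _ -> //].
case: c d => [X f g] [X' f' g'] [/= a [-> ->]]; exact: stepF.
Qed.

(* [V -> W _|_ W' <- W], with i_W on the right. *)
Definition Tq_canon V W W' (f : qmor V (osum W W')) : Tq_hom V W :=
  Tq_class (Cospan f (oinl W W')).

Lemma Tq_canonical V W (t : Tq_hom V W) :
  exists W' (f : qmor V (osum W W')), t = Tq_canon f.
Proof.
rewrite -(Tq_reprK t); case: (Tq_repr t) => X f g.
exists (ocompl g), (qcomp (osplit g) f).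
apply: (Tq_class_step (a := osplit g)) => // w /=.
by rewrite /osplit_fun /oinl_fun oprojK subrr linear0.
Qed.

Definition cospan_comp V W Z (d : cospan W Z) (c : cospan V W) : cospan V Z :=
  Cospan
    (qcomp (osum_mor (legl d) (qid (ocompl (legr c))))
       (qcomp (osplit (legr c)) (legl c)))
    (qcomp (oinl (apex d) (ocompl (legr c))) (legr d)).

Section ComplementMorphism.
Variables (W X X' : quadSpace) (g : qmor W X) (a : qmor X X').

Lemma ocompl_mor_sub (x : ocompl g) : a (vsval x) \in ocompl_space (qcomp a g).
Proof.
apply/ocompl_spaceP => w.
by rewrite [qcomp a g w]/(a (g w)) qlin_B (ocompl_spaceP _ _ (valP x)).
Qed.

Definition ocompl_mor_fun (x : ocompl g) : ocompl (qcomp a g) :=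
  vsproj (ocompl_space (qcomp a g)) (a (vsval x)).

Lemma ocompl_mor_linear : linear ocompl_mor_fun.
Proof. by move=> k x y; rewrite /ocompl_mor_fun !linearP. Qed.
HB.instance Definition _ := GRing.isLinear.Build 'F_2 (ocompl g)
  (ocompl (qcomp a g)) _ ocompl_mor_fun ocompl_mor_linear.
Lemma ocompl_mor_q x : qform (ocompl_mor_fun x) = qform x.
Proof.
by rewrite /= /ocompl_form vsprojK ?ocompl_mor_sub // qlin_q.
Qed.
Definition ocompl_mor : qmor (ocompl g) (ocompl (qcomp a g)) :=
  QMor ocompl_mor_q.

End ComplementMorphism.

Section ComplementInl.
Variables W W' : quadSpace.

Lemma ocompl_inl_sub (w : W') :
  ((0, w) : osum W W') \in ocompl_space (oinl W W').
Proof.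
by apply/ocompl_spaceP => v; rewrite /qB [LHS]osum_polar qB0l qB0r addr0.
Qed.

Definition ocompl_inl_fun (w : W') : ocompl (oinl W W') :=
  vsproj (ocompl_space (oinl W W')) (0, w).
Lemma ocompl_inl_linear : linear ocompl_inl_fun.
Proof.
move=> a x y; rewrite /ocompl_inl_fun -linearP; congr (vsproj _ _).
by congr (_, _); rewrite /= scaler0 addr0.
Qed.
HB.instance Definition _ := GRing.isLinear.Build 'F_2 W'
  (ocompl (oinl W W')) _ ocompl_inl_fun ocompl_inl_linear.
Lemma ocompl_inl_q x : qform (ocompl_inl_fun x) = qform x.
Proof.
by rewrite /= /ocompl_form vsprojK ?ocompl_inl_sub //= /osum_form qform0 add0r.
Qed.
Definition ocompl_inl : qmor W' (ocompl (oinl W W')) := QMor ocompl_inl_q.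

End ComplementInl.

Section OrthogonalSumAssoc.
Variables U V W : quadSpace.

Definition oassoc_fun (x : osum (osum U V) W) : osum U (osum V W) :=
  (x.1.1, (x.1.2, x.2)).
Lemma oassoc_linear : linear oassoc_fun.
Proof. by []. Qed.
HB.instance Definition _ := GRing.isLinear.Build 'F_2 (osum (osum U V) W)
  (osum U (osum V W)) _ oassoc_fun oassoc_linear.
Lemma oassoc_q x : qform (oassoc_fun x) = qform x.
Proof. by rewrite /= /osum_form /= /osum_form addrA. Qed.
Definition oassoc : qmor (osum (osum U V) W) (osum U (osum V W)) :=
  QMor oassoc_q.

End OrthogonalSumAssoc.

Lemma cospan_comp_class V W Z (d d' : cospan W Z) (c c' : cospan V W) :
  Tq_class d = Tq_class d' -> Tq_class c = Tq_class c' ->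
  Tq_class (cospan_comp d c) = Tq_class (cospan_comp d' c').
Proof.
move=> ed ec; transitivity (Tq_class (cospan_comp d' c)).
  move: d d' ed; apply: Tq_ind => Y Y' h k a.
  by apply: (Tq_class_step (a := osum_mor a (qid _))).
move: c c' ec; apply: Tq_ind => X X' f g a.
apply: (Tq_class_step (a := osum_mor (qid _) (ocompl_mor g a))) => v; last first.
  by congr (_, _); rewrite /= linear0.
have e := oproj_qcomp g a (f v).
congr (_, _); first by congr (legl d' _); exact: e.
rewrite [RHS]/(vsproj _ (a (vsval (vsproj _ _)))) vsprojK ?ocompl_sub //.
by rewrite [LHS]/(vsproj _ (a (f v) - a (g (oproj (qcomp a g) (a (f v)))))) e linearB.
Qed.

(* Well defined on classes by cospan_comp_class; Tq_comp_canonE is its usual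
   expression on representatives V -> W _|_ W' <- W. *)
Definition Tq_comp V W Z (s : Tq_hom W Z) (t : Tq_hom V W) : Tq_hom V Z :=
  Tq_class (cospan_comp (Tq_repr s) (Tq_repr t)).

Lemma Tq_compE V W Z (d : cospan W Z) (c : cospan V W) :
  Tq_comp (Tq_class d) (Tq_class c) = Tq_class (cospan_comp d c).
Proof. by apply: cospan_comp_class; rewrite Tq_reprK. Qed.

Lemma Tq_comp_canon V W W' Z Y (h : qmor W Y) (k : qmor Z Y)
    (f : qmor V (osum W W')) :
  Tq_comp (Tq_class (Cospan h k)) (Tq_canon f) =
  Tq_class (Cospan (qcomp (osum_mor h (qid W')) f) (qcomp (oinl Y W') k)).
Proof.
rewrite Tq_compE; apply: esym.
apply: (Tq_class_step (a := osum_mor (qid _) (ocompl_inl W W'))) => v; last first.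
  by congr (_, _); rewrite /= linear0.
have e : oproj (oinl W W') (f v) = (f v).1 := oproj_oinl (f v).
congr (_, _); first by congr (h _); exact: e.
rewrite [LHS]/(vsproj _ (f v - oinl W W' (oproj (oinl W W') (f v)))) e.
congr (vsproj _ _); rewrite [f v in LHS]surjective_pairing.
by congr (_, _); rewrite /= ?subrr ?subr0.
Qed.

Lemma Tq_comp_canonE V W W' Z L (phi : qmor W (osum Z L))
    (f : qmor V (osum W W')) :
  Tq_comp (Tq_canon phi) (Tq_canon f) =
  Tq_canon (qcomp (oassoc Z L W') (qcomp (osum_mor phi (qid W')) f)).
Proof.
by rewrite Tq_comp_canon; apply: (Tq_class_step (a := oassoc Z L W')).
Qed.

Definition Tq_id V : Tq_hom V V := Tq_class (Cospan (qid V) (qid V)).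

Definition Tq : category.
Proof.
apply: (@Category quadSpace Tq_hom Tq_id Tq_comp).
- move=> V W t; have [W' [f ->]] := Tq_canonical t.
  rewrite Tq_comp_canon; congr Tq_class; congr Cospan; apply: qmor_eq => // v /=.
  by rewrite /osum_fun /= -surjective_pairing.
- move=> V W t; rewrite -(Tq_reprK t) Tq_compE.
  case: (Tq_repr t) => Y h k; apply: esym.
  apply: (Tq_class_step (a := oinl Y (ocompl (qid V)))) => // v /=.
  have e : oproj (qid V) v = v := oprojK (qid V) v.
  by congr (_, _); rewrite /= ?e // subrr linear0.
- move=> V W Z T r s t.
  have [W' [f ->]] := Tq_canonical t; have [L [phi ->]] := Tq_canonical s.
  rewrite -(Tq_reprK r); case: (Tq_repr r) => Y h k.
  rewrite Tq_comp_canonE !Tq_comp_canon; apply: esym.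
  by apply: (Tq_class_step (a := oassoc Y L W')).
Defined.

(* For g = i_W this is p_W o f (eps_canonE). *)
Definition cospan_proj V W (c : cospan V W) : {linear V -> W} :=
  lin_comp (oproj (legr c)) (legl c).

Lemma cospan_proj_class V W (c c' : cospan V W) :
  Tq_class c = Tq_class c' -> cospan_proj c = cospan_proj c'.
Proof.
move: c c'; apply: Tq_ind => X X' f g a.
by apply: linear_eq => v; apply: esym; exact: oproj_qcomp.
Qed.

Definition eps_hom V W (t : Tq_hom V W) : {linear V -> W} :=
  cospan_proj (Tq_repr t).

Lemma eps_homE V W (c : cospan V W) : eps_hom (Tq_class c) = cospan_proj c.
Proof. by apply: cospan_proj_class; rewrite Tq_reprK. Qed.

Lemma eps_canonE V W W' (f : qmor V (osum W W')) :
  eps_hom (Tq_canon f) = lin_comp (oprl W W') f.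
Proof. by rewrite eps_homE; apply: linear_eq => v; exact: oproj_oinl. Qed.

Definition eps : functor Tq FinVec.
Proof.
exists (fun V : Tq => qcar V : FinVec) (fun V W t => eps_hom t).
- move=> V; rewrite [idc V]/(Tq_class _) eps_homE.
  by apply: linear_eq => v; exact: (oprojK (qid V)).
- move=> V W Z s t; have [W' [f ->]] := Tq_canonical t.
  have [L [phi ->]] := Tq_canonical s.
   transitivity (eps_hom (Tq_comp (Tq_canon phi) (Tq_canon f))) => //.
  by rewrite Tq_comp_canonE !eps_canonE; exact: linear_eq.
Defined.

Definition Fcat : category := functor_cat FinVec Vec.
Definition Fquad : category := functor_cat Tq Vec.

Definition iota : functor Fcat Fquad := precomposition Vec eps.

(* Main.v *)
(** The category T_q carries an idempotent endomorphism e of its identity functor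
    such that s o e = t o e whenever eps s = eps t.  On V it is the class of
    v |-> (v, (v, 0)) in V _|_ H(V), where H(V) = V (+) V^* is hyperbolic.  Since
    eps is full and eps e = 1, a functor G is isomorphic to some iota F exactly
    when G(e) is the identity.  The natural idempotent endomorphism G(e) of G is
    compatible with all morphisms of F_quad; hence if it is the identity on H, it
    is so on subobjects and quotients of H.  If it is the identity on both ends
    of a short exact sequence, G(e) - 1 factors through the subobject and is
    therefore killed by G(e) - 1; an idempotent e with (e - 1)^2 = 0 is 1. *)
From HB Require Import structures.
From mathcomp Require Import all_boot all_order all_algebra boolp.
Require Import Defs.

Set Implicit Arguments.
Unset Strict Implicit.
Unset Printing Implicit Defensive.

Import GRing.Theory.
Local Open Scope ring_scope.

(** * Hyperbolic spaces in characteristic two *)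

Lemma lmodF2_add_self (U : lmodType 'F_2) (u : U) : u + u = 0.
Proof. by rewrite -[u]scale1r -scalerDl F2_add_self scale0r. Qed.

Lemma qB_alt (V : quadSpace) (x : V) : qB x x = 0.
Proof. by rewrite /qB /polar lmodF2_add_self qform0 add0r F2_add_self. Qed.

Section Hyperbolic.
Variable E : vectType 'F_2.

Local Notation dual := 'Hom(E, ('F_2)^o).
Local Notation hcar := (E * dual)%type.

Definition hyper_form (x : hcar) : 'F_2 := x.2 x.1.

Lemma hyper_polar x y : polar hyper_form x y = x.2 y.1 + y.2 x.1.
Proof.
rewrite /polar /hyper_form /= add_lfunE !linearD /=.
set a := x.2 x.1; set b := x.2 y.1; set c := y.2 x.1; set d := y.2 y.1.
rewrite addrAC -!addrA (addrA d d) F2_add_self add0r.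
by rewrite addrC -!addrA F2_add_self addr0.
Qed.

Lemma hyper_homog a x : hyper_form (a *: x) = a ^+ 2 * hyper_form x.
Proof. by rewrite /hyper_form /= scale_lfunE linearZ /= expr2 -mulrA. Qed.

Lemma hyper_bilin : bilinear_for *%R *%R (polar hyper_form).
Proof.
split=> z a x y; rewrite !hyper_polar /=.
- by rewrite add_lfunE scale_lfunE linearP /= [in RHS]mulrDr addrACA.
- by rewrite add_lfunE scale_lfunE linearP /= [in RHS]mulrDr addrACA.
Qed.

Lemma hyper_nondeg x : (forall y, polar hyper_form x y = 0) -> x = 0.
Proof.
move=> x0; rewrite [x]surjective_pairing; congr (_, _); last first.
  apply/lfunP => y; have := x0 (y, 0).
  by rewrite hyper_polar /= !zero_lfunE addr0.
(* Pairing with the coordinate forms shows that every coordinate of [x.1] vanishes. *)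
rewrite (coord_vbasis (memvf x.1)) big1 // => i _.
have := x0 (0, linfun (coord (vbasis fullv) i : E -> ('F_2)^o)).
by rewrite hyper_polar /= linear0 add0r lfunE /= => ->; rewrite scale0r.
Qed.

Definition hyper : quadSpace := QuadSpace hyper_homog hyper_bilin hyper_nondeg.

Definition hyper_inl_fun (x : E) : hyper := (x, 0).
Lemma hyper_inl_linear : linear hyper_inl_fun.
Proof. by move=> a x y; congr (_, _); rewrite /= scaler0 addr0. Qed.
HB.instance Definition _ :=
  GRing.isLinear.Build 'F_2 E hyper _ hyper_inl_fun hyper_inl_linear.

Definition hyper_inl : {linear E -> hyper} := hyper_inl_fun.
Definition hyper_prl : {linear hyper -> E} := fst.

Lemma hyper_inl_q x : qform (hyper_inl x) = 0.
Proof. by rewrite /= /hyper_form /= zero_lfunE. Qed.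

End Hyperbolic.

(** This is $\varphi \oplus 0$, in general no isometry; for the identity of $E$ it is the projection
    of $H(E)$ onto $E$. *)
Definition hyper_map (E E' : vectType 'F_2) (phi : {linear E -> E'}) :
  {linear hyper E -> hyper E'} :=
  lin_comp (hyper_inl E') (lin_comp phi (hyper_prl E)).

(** * The idempotent endomorphism $e$ of the identity functor *)

(* A class [V -> W _|_ W' <- W] is determined by its image under eps and by the
   subspace of V that the left leg sends into W.  The endomorphism gen V lies
   over the identity of V and has zero subspace. *)
Section GenericEndomorphism.
Variable V : quadSpace.

Definition gen_fun (v : V) : osum V (hyper V) := (v, hyper_inl V v).
Lemma gen_linear : linear gen_fun.
Proof. by move=> a x y; congr (_, _); rewrite linearP. Qed.
HB.instance Definition _ :=
  GRing.isLinear.Build 'F_2 V (osum V (hyper V)) _ gen_fun gen_linear.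
Lemma gen_q v : qform (gen_fun v) = qform v.
Proof. by rewrite /= /osum_form hyper_inl_q addr0. Qed.

Definition gen_mor : qmor V (osum V (hyper V)) := QMor gen_q.

Definition gen : Tq_hom V V := Tq_canon gen_mor.

Lemma eps_gen : eps_hom gen = lin_id V.
Proof. by rewrite eps_canonE; exact: linear_eq. Qed.

End GenericEndomorphism.

(* W' embeds isometrically in W' _|_ H(V) as the graph of (r, 0), because
   V (+) 0 is totally isotropic in H(V). *)
Section Absorb.
Variables (V W W' : quadSpace) (f : qmor V (osum W W')) (r : {linear W' -> V}).
Hypothesis rK : forall v, r (f v).2 = v.

Definition graph_fun (x : osum W W') : osum W (osum W' (hyper V)) :=
  (x.1, (x.2, hyper_inl V (r x.2))).
Lemma graph_linear : linear graph_fun.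
Proof. by move=> a x y; congr (_, (_, _)); rewrite !linearP. Qed.
HB.instance Definition _ := GRing.isLinear.Build 'F_2 (osum W W')
  (osum W (osum W' (hyper V))) _ graph_fun graph_linear.
Lemma graph_q x : qform (graph_fun x) = qform x.
Proof. by rewrite /= /osum_form /= /osum_form hyper_inl_q addr0. Qed.
Definition graph_mor := QMor graph_q.

Lemma comp_gen_id : Tq_comp (Tq_canon f) (gen V) = Tq_canon f.
Proof.
rewrite /gen Tq_comp_canonE; apply: esym.
(* By [rK], the graph adds to [f v] the hyperbolic component $(v,0)$, exactly as [gen] does. *)
apply: (Tq_class_step (a := graph_mor)) => [v|w].
  by congr (_, (_, _)); rewrite /= rK.
by congr (_, (_, _)); rewrite /= !linear0.
Qed.

End Absorb.

(* f1 and f2 have a common component on W, so their components a1 and a2 on W1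
   and W2 pull the forms back to the same form on V.  The two isometric
   embeddings amalg_l and amalg_r into W _|_ W1 _|_ W2 _|_ H(V) identify
   (a1 v, (v, 0)) with (a2 v, (v, 0)). *)
Section Generic.
Variables (V W W1 W2 : quadSpace).
Variables (f1 : qmor V (osum W W1)) (f2 : qmor V (osum W W2)).
Hypothesis f12 : forall v, (f1 v).1 = (f2 v).1.

Let a1 v : W1 := (f1 v).2.
Let a2 v : W2 := (f2 v).2.

Let a1P k x y : a1 (k *: x + y) = k *: a1 x + a1 y.
Proof. by rewrite /a1 linearP. Qed.
Let a2P k x y : a2 (k *: x + y) = k *: a2 x + a2 y.
Proof. by rewrite /a2 linearP. Qed.

Let qa v : qform (a1 v) = qform (a2 v).
Proof.
apply: (addrI (qform (f1 v).1)).
rewrite {2}f12 -[LHS]/(qform (f1 v)) -[RHS]/(qform (f2 v)).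
by rewrite !qlin_q.
Qed.

(** The transpose of [a2] for the bilinear form $B$. *)
Definition transp_fun (w : W2) (x : V) : ('F_2)^o := qB w (f2 x).2.
Lemma transp_linear w : linear (transp_fun w).
Proof. by move=> k x y; rewrite /transp_fun linearP /= qB_addr qB_scaler. Qed.
HB.instance Definition _ w :=
  GRing.isLinear.Build 'F_2 V ('F_2)^o _ (transp_fun w) (transp_linear w).
Definition transp (w : W2) : 'Hom(V, ('F_2)^o) := linfun (transp_fun w).

Lemma transpE w x : transp w x = qB w (f2 x).2.
Proof. by rewrite lfunE. Qed.

Lemma transp_mor_linear : linear transp.
Proof.
move=> k w w'; apply/lfunP => x.
by rewrite add_lfunE scale_lfunE !transpE qB_addl qB_scalel.
Qed.
HB.instance Definition _ := GRing.isLinear.Build 'F_2 W2 'Hom(V, ('F_2)^o) _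
  transp transp_mor_linear.

Local Notation common := (osum W (osum W1 (osum W2 (hyper V)))).

Definition amalg_l_fun (y : osum W (osum W1 (hyper V))) : common :=
  (y.1, (y.2.1, (0, y.2.2))).
Lemma amalg_l_linear : linear amalg_l_fun.
Proof. by move=> k x y; congr (_, (_, (_, _))); rewrite /= scaler0 addr0. Qed.
HB.instance Definition _ := GRing.isLinear.Build 'F_2
  (osum W (osum W1 (hyper V))) common _ amalg_l_fun amalg_l_linear.
Lemma amalg_l_q y : qform (amalg_l_fun y) = qform y.
Proof. by rewrite /= /osum_form /= /osum_form /= /osum_form qform0 add0r. Qed.
Definition amalg_l_mor := QMor amalg_l_q.

(** The entry [w2 + a2 x] vanishes when [w2 = a2 x]. The form gains $q(a_1x)+q(a_2x)$, which is zero
    by [qa], and $B(w_2,a_2x)$, which the shift of [h] by [transp] cancels. *)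
Definition amalg_r_fun (y : osum W (osum W2 (hyper V))) : common :=
  let: (w, (w2, (x, h))) := y in
  (w, (a1 x, (w2 + a2 x, (x, h + transp (w2 + a2 x))))).
Lemma amalg_r_linear : linear amalg_r_fun.
Proof.
move=> k [w [w2 [x h]]] [w' [w2' [x' h']]] /=.
have e : k *: w2 + w2' + a2 (k *: x + x') =
    k *: (w2 + a2 x) + (w2' + a2 x') by rewrite a2P scalerDr addrACA.
congr (_, (_, (_, (_, _)))); [exact: a1P | exact: e |].
transitivity (k *: h + h' + (k *: transp (w2 + a2 x) + transp (w2' + a2 x'))).
  by congr (_ + _); rewrite -linearP -e.
by rewrite addrACA -scalerDr.
Qed.
HB.instance Definition _ := GRing.isLinear.Build 'F_2
  (osum W (osum W2 (hyper V))) common _ amalg_r_fun amalg_r_linear.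
Lemma amalg_r_q y : qform (amalg_r_fun y) = qform y.
Proof.
case: y => w [w2 [x h]].
rewrite /= /osum_form /= /osum_form /= /osum_form /= /hyper_form /=.
congr (_ + _); rewrite add_lfunE transpE qB_addl.
rewrite -[(f2 x).2]/(a2 x) qformD qa qB_alt addr0.
move: (qform (a2 x)) (qform w2) (qB _ _) (h x : 'F_2) => p s t u.
rewrite (addrC s) -!addrA (addrA p p) F2_add_self add0r.
by rewrite (addrCA t u) F2_add_self addr0.
Qed.
Definition amalg_r_mor := QMor amalg_r_q.

Lemma comp_gen_canon :
  Tq_comp (Tq_canon f1) (gen V) = Tq_comp (Tq_canon f2) (gen V).
Proof.
rewrite /gen !Tq_comp_canonE.
set g1 := qcomp _ _; set g2 := qcomp _ _.
transitivity (Tq_class (Cospan (qcomp amalg_l_mor g1)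
    (oinl W (osum W1 (osum W2 (hyper V)))))).
  by apply: (Tq_class_step (a := amalg_l_mor)).
apply: esym; apply: (Tq_class_step (a := amalg_r_mor)) => [v|w].
  have e : a2 v + a2 v = 0 := lmodF2_add_self _.
  rewrite /= -/(a2 v) e linear0 addr0.
  by congr (_, _); exact: f12.
rewrite /= /amalg_r_fun /=.
have -> : a1 0 = 0 by rewrite /a1 linear0.
have -> : a2 0 = 0 by rewrite /a2 linear0.
by rewrite addr0 linear0 addr0.
Qed.

End Generic.

(** On canonical representatives [eps_hom] is the $W$-component of the left leg, so equal images
    give the hypothesis of [comp_gen_canon]. *)
Lemma comp_gen_eps V W (s t : Tq_hom V W) : eps_hom s = eps_hom t ->
  Tq_comp s (gen V) = Tq_comp t (gen V).
Proof.
have [W1 [f1 ->]] := Tq_canonical s; have [W2 [f2 ->]] := Tq_canonical t.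
rewrite !eps_canonE => e; apply: comp_gen_canon => v.
exact: (congr1 (fun h : {linear V -> W} => h v) e).
Qed.

Section HyperbolicCollapse.
Variables W W' : quadSpace.

Definition hyper_collapse_fun (y : osum (hyper W) W') : osum W W' :=
  (y.1.1, y.2).
Lemma hyper_collapse_linear : linear hyper_collapse_fun.
Proof. by []. Qed.
HB.instance Definition _ := GRing.isLinear.Build 'F_2 (osum (hyper W) W')
  (osum W W') _ hyper_collapse_fun hyper_collapse_linear.
Definition hyper_collapse : {linear osum (hyper W) W' -> osum W W'} :=
  hyper_collapse_fun.

End HyperbolicCollapse.

(** The complementary component of [gen W] after [s] is injective, so this composite absorbs [gen V]
    on the right; it has the same image under [eps] as [s], and [comp_gen_eps] applies. *)
Lemma gen_central V W (s : Tq_hom V W) :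
  Tq_comp (gen W) s = Tq_comp s (gen V).
Proof.
have [W' [f ->]] := Tq_canonical s.
have <- : Tq_comp (Tq_comp (gen W) (Tq_canon f)) (gen V) =
    Tq_comp (gen W) (Tq_canon f).
  rewrite {1 3}/gen Tq_comp_canonE.
  (* The complementary component at [v] is [(((f v).1, 0), (f v).2)]: collapsing it recovers [f v],
     and [oproj f] then recovers [v]. *)
  apply: (comp_gen_id (r := lin_comp (oproj f) (hyper_collapse W W'))) => v.
  by rewrite /= /hyper_collapse_fun /= -surjective_pairing; exact: oprojK.
apply: comp_gen_eps.
rewrite [LHS](fmap_comp eps (gen W : @hom Tq W W) (Tq_canon f : @hom Tq V W)).
by rewrite [fmap eps _]eps_gen; exact: (@comp_idl FinVec).
Qed.

Lemma gen_idem V : Tq_comp (gen V) (gen V) = gen V.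
Proof.
rewrite (comp_gen_eps (t := Tq_id V)); first exact: (@comp_idl Tq).
by rewrite eps_gen; apply: esym; exact: (fmap_id eps).
Qed.

(** * Fullness of $\epsilon$ *)

Section Lift.
Variables (V W : quadSpace) (phi : {linear V -> W}).

(** The second [phi v] cancels the form of the first in characteristic two. *)
Definition lift_fun (v : V) : osum W (osum V W) := (phi v, (v, phi v)).
Lemma lift_linear : linear lift_fun.
Proof. by move=> k x y; congr (_, (_, _)); rewrite linearP. Qed.
HB.instance Definition _ :=
  GRing.isLinear.Build 'F_2 V (osum W (osum V W)) _ lift_fun lift_linear.
Lemma lift_q v : qform (lift_fun v) = qform v.
Proof.
by rewrite /= /osum_form /= /osum_form /= addrCA F2_add_self addr0.
Qed.
Definition lift : Tq_hom V W := Tq_canon (QMor lift_q).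

Lemma eps_lift : eps_hom lift = phi.
Proof. by rewrite eps_canonE; exact: linear_eq. Qed.

End Lift.

(** * Fixed points of a linear endomorphism *)

Section FixedPoints.
Variables (R : pzRingType) (U : lmodType R) (p : {linear U -> U}).

Definition fixed : {pred U} := fun x => p x == x.

Lemma fixed_submod : submod_closed fixed.
Proof.
split=> [|k x y /eqP ex /eqP ey]; first by rewrite unfold_in linear0.
by rewrite unfold_in linearP ex ey.
Qed.
HB.instance Definition _ := GRing.isSubmodClosed.Build R U fixed
  (GRing.submod_closed_semi fixed_submod).

(** For an idempotent [p] this is its image, so it splits [p]. *)
Record fixpt := Fixpt { fixpt_val :> U; fixpt_prop : fixpt_val \in fixed }.
HB.instance Definition _ := [isSub for fixpt_val].
HB.instance Definition _ := [Choice of fixpt by <:].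
HB.instance Definition _ := [SubChoice_isSubLmodule of fixpt by <:].

Definition fix_inc : {linear fixpt -> U} := \val.

Lemma fix_incP (x : fixpt) : p (fix_inc x) = fix_inc x.
Proof. exact: eqP (fixpt_prop x). Qed.

Lemma fix_inc_inj : injective fix_inc.
Proof. exact: val_inj. Qed.

Variables (T : lmodType R) (h : {linear T -> U}).
Hypothesis hP : forall x, p (h x) = h x.

Definition fix_cores_fun (x : T) : fixpt := Fixpt (introT eqP (hP x)).
Lemma fix_cores_linear : linear fix_cores_fun.
Proof. by move=> k x y; apply: val_inj; rewrite /= linearP. Qed.
HB.instance Definition _ :=
  GRing.isLinear.Build R T fixpt _ fix_cores_fun fix_cores_linear.
Definition fix_cores : {linear T -> fixpt} := fix_cores_fun.

Lemma fix_coresK x : fix_inc (fix_cores x) = h x.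
Proof. by []. Qed.

End FixedPoints.

(** * Extension of a functor along $\epsilon$ *)

Section Extension.
Variable G : functor Tq Vec.
Hypothesis G_gen : forall V : Tq, fmap G (gen V : hom V V) = idc (G V).

(** Since $G(e)=1$, both sides may be precomposed with $G(e)$, and $se=te$. *)
Lemma fmap_eps (V W : Tq) (s t : hom V W) :
  eps_hom s = eps_hom t -> fmap G s = fmap G t.
Proof.
move=> e; rewrite -[LHS]comp_idr -[RHS]comp_idr -G_gen -!fmap_comp.
by congr fmap; exact: comp_gen_eps.
Qed.

Definition ext_map (V W : quadSpace) (phi : {linear V -> W}) :
  {linear G V -> G W} := fmap G (lift phi : @hom Tq V W).

Lemma ext_map_eps (V W : Tq) (s : hom V W) x :
  ext_map (eps_hom s) x = (fmap G s : {linear _ -> _}) x.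
Proof. by rewrite /ext_map (fmap_eps (t := s)) // eps_lift. Qed.

Lemma ext_map_id (V : quadSpace) (phi : {linear V -> V}) x :
  phi =1 id -> ext_map phi x = x.
Proof.
move=> e; have -> : phi = eps_hom (Tq_id V).
  by transitivity (lin_id V); [exact: linear_eq | exact: esym (fmap_id eps V)].
by rewrite (ext_map_eps (idc (V : Tq))) fmap_id.
Qed.

(** The composite is a separate [rho], equal to it pointwise, so that later uses settle the equation
    by computation. *)
Lemma ext_map_comp (V W X : quadSpace) (psi : {linear W -> X})
    (phi : {linear V -> W}) (rho : {linear V -> X}) x :
  rho =1 psi \o phi -> ext_map psi (ext_map phi x) = ext_map rho x.
Proof.
move=> e; pose s : @hom Tq V W := lift phi; pose t : @hom Tq W X := lift psi.
have -> : rho = eps_hom (comp t s).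
  transitivity (lin_comp (eps_hom t) (eps_hom s)).
    by apply: linear_eq => v; rewrite /s /t !eps_lift e.
  exact: esym (fmap_comp eps t s).
by rewrite ext_map_eps fmap_comp.
Qed.

(* Nondegenerate spaces have even dimension, so eps is not essentially
   surjective: a general E is only the retract of H(E), and the extension takes
   on E the image of the corresponding idempotent of G(H(E)). *)
Definition ext_idem (E : vectType 'F_2) := ext_map (hyper_map (lin_id E)).

Definition ext_ob (E : vectType 'F_2) : lmodType 'F_2 := fixpt (ext_idem E).

Lemma ext_fmap_subproof (E E' : vectType 'F_2) (phi : {linear E -> E'}) x :
  ext_idem E' (lin_comp (ext_map (hyper_map phi)) (fix_inc (ext_idem E)) x) =
  lin_comp (ext_map (hyper_map phi)) (fix_inc (ext_idem E)) x.
Proof. exact: ext_map_comp. Qed.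

Definition ext_fmap (E E' : vectType 'F_2) (phi : {linear E -> E'}) :
  {linear ext_ob E -> ext_ob E'} := fix_cores (ext_fmap_subproof phi).

Definition extension : Fcat.
Proof.
exists (fun E : FinVec => ext_ob E : Vec) (fun E E' phi => ext_fmap phi).
- move=> E; apply: linear_eq => x; apply: fix_inc_inj; rewrite fix_coresK.
  (* The identity of [E] induces [ext_idem E], which is the identity only on its fixed points. *)
  exact: fix_incP.
- move=> E E' E'' psi phi; apply: linear_eq => x; apply: fix_inc_inj.
  rewrite [LHS]fix_coresK [RHS]fix_coresK /=; apply: esym; exact: ext_map_comp.
Defined.

Lemma ext_in_subproof (V : quadSpace) x :
  ext_idem V (ext_map (hyper_inl V) x) = ext_map (hyper_inl V) x.
Proof. exact: ext_map_comp. Qed.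

Definition ext_in : nattrans G (iota extension).
Proof.
exists (fun V : Tq => fix_cores (@ext_in_subproof V)).
move=> V W s; apply: linear_eq => x; apply: fix_inc_inj.
rewrite [LHS]fix_coresK [RHS]fix_coresK /= -ext_map_eps.
rewrite (ext_map_comp (rho := lin_comp (hyper_inl W) (eps_hom s))) //.
by apply: esym; exact: ext_map_comp.
Defined.

Definition ext_out : nattrans (iota extension) G.
Proof.
exists (fun V : Tq => lin_comp (ext_map (hyper_prl V)) (fix_inc (ext_idem V))).
move=> V W s; apply: linear_eq => x; rewrite [RHS]/= -ext_map_eps.
transitivity (ext_map (hyper_prl W)
  (ext_map (hyper_map (eps_hom s)) (fix_inc (ext_idem V) x))); first by [].
rewrite (ext_map_comp (rho := lin_comp (eps_hom s) (hyper_prl V))) //.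
by apply: esym; exact: ext_map_comp.
Defined.

(** [hyper_inl] followed by [hyper_prl] is the identity of $V$; in the other order they give the map
    defining [ext_idem]. Hence [ext_in] and [ext_out] are mutually inverse. *)
Lemma ess_image_extension : ess_image iota G.
Proof.
exists extension; exists ext_out, ext_in.
split; apply: nattrans_eq => V; apply: linear_eq => x /=.
- apply: fix_inc_inj; rewrite [LHS]fix_coresK /=.
  by rewrite (ext_map_comp (rho := hyper_map (lin_id V))) // fix_incP.
- by rewrite (ext_map_comp (rho := lin_id V)) // ext_map_id.
Qed.

End Extension.

(** * The essential image in terms of $G(e)$ *)

Lemma ess_imageP (G : functor Tq Vec) :
  ess_image iota G <-> forall V : Tq, fmap G (gen V : hom V V) = idc (G V).
Proof.
split=> [[F [a [b [_ ab]]]] V|]; last exact: ess_image_extension.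
have abV : comp (a V) (b V) = idc (G V)
  by rewrite -[RHS]/(nt_id G V) -[nt_id G]ab.
(* Naturality of [a] turns $G(e)$ into $a \circ \iota(F)(e) \circ b$, and $\epsilon(e)=1$. *)
rewrite -[LHS]comp_idr -abV comp_assoc -nt_natural -comp_assoc.
have -> : fmap (iota F) (gen V : hom V V) = idc (iota F V).
  transitivity (fmap F (idc (eps V)));
    last exact: (@fmap_id FinVec Vec F (eps V)).
  exact: (congr1 (@fmap FinVec Vec F (eps V) (eps V)) (eps_gen V)).
by rewrite comp_idl.
Qed.

Definition gen_nat (G : Fquad) : hom G G.
Proof.
exists (fun V : Tq => fmap G (gen V : hom V V)) => V W s.
by rewrite -!fmap_comp; congr fmap; exact: gen_central.
Defined.

Lemma gen_nat_natural (G H : Fquad) (a : hom G H) :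
  comp a (gen_nat G) = comp (gen_nat H) a.
Proof. by apply: nattrans_eq => V; exact: nt_natural. Qed.

Lemma gen_natP (G : Fquad) : ess_image iota G <-> gen_nat G = idc G.
Proof.
rewrite ess_imageP; split=> [e|e V]; first exact: nattrans_eq.
by rewrite -[LHS]/(nt (gen_nat G) V) e.
Qed.

(** * Zero morphisms and differences in functor categories *)

Definition lin_zero (U V : Vec) : hom U V :=
  (\0 : U -> V) : {linear U -> V}.

Definition lin_sub (U V : Vec) (f g : hom U V) : hom U V :=
  (f : {linear U -> V}) \- (g : {linear U -> V}) : {linear U -> V}.

Section VecFunctors.
Variable C : category.

Definition zero_functor : functor C Vec.
Proof.
by exists (fun=> 'rV['F_2]_0 : lmodType 'F_2) (fun x y f => lin_id _) => *;
  exact: linear_eq.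
Defined.

Definition zero_to (G : functor C Vec) : nattrans zero_functor G.
Proof.
exists (fun x : C => lin_zero _ _) => x y f.
by apply: linear_eq => v /=; rewrite linear0.
Defined.

Definition to_zero (G : functor C Vec) : nattrans G zero_functor.
Proof. by exists (fun x : C => lin_zero _ _) => x y f; exact: linear_eq. Defined.

Lemma zero_functorP : @zero_object (functor_cat C Vec) zero_functor.
Proof.
split=> G.
- exists (to_zero G); split=> // a _; apply: nattrans_eq => x.
  by apply: linear_eq => v; apply: esym; exact: thinmx0.
- exists (zero_to G); split=> // a _; apply: nattrans_eq => x.
  by apply: linear_eq => v; rewrite [v]thinmx0 !linear0.
Qed.

(** Lets the universal property of a kernel be applied after a pointwise check. *)
Lemma zero_nattrans (G H : functor C Vec) (a : nattrans G H) :
  (forall x v, (a x : {linear _ -> _}) v = 0) ->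
  @zero_morphism (functor_cat C Vec) G H a.
Proof.
move=> a0; exists zero_functor, (to_zero G), (zero_to H).
split; first exact: zero_functorP.
by apply: nattrans_eq => x; apply: linear_eq => v; rewrite a0.
Qed.

Definition nt_sub (G H : functor C Vec) (a b : nattrans G H) : nattrans G H.
Proof.
exists (fun x : C => lin_sub (a x) (b x)) => x y f.
apply: linear_eq => v /=; rewrite linearB.
have na (c : nattrans G H) := congr1 (fun h : {linear _ -> _} => h v)
  (nt_natural c f).
by move: (na a) (na b) => /= -> ->.
Defined.

End VecFunctors.

(** * Subobjects, quotients and extensions *)

Theorem theorem2p16 : thick (ess_image iota).
Proof.
split.
(* [imono] cancels $i$ in $i\,G(e)=H(e)\,i=i$. *)
- move=> G H i imono /gen_natP eH; apply/gen_natP; apply: imono.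
  by rewrite gen_nat_natural eH comp_idr comp_idl.
- move=> G H p pepi /gen_natP eG; apply/gen_natP; apply: pepi.
  by rewrite -gen_nat_natural eG comp_idl comp_idr.
move=> G H K i p [[_ ker_i] _] /ess_imageP eG /ess_imageP eK.
apply/ess_imageP => V; apply: linear_eq => v.
(* [d] is $H(e)-1$; its composite with [p] vanishes because $K(e)=1$, so it factors as $iu$. *)
pose d : @hom Fquad H H := nt_sub (gen_nat H) (nt_id H).
have [|u [iu _]] := ker_i H d.
  apply: zero_nattrans => W w.
  rewrite /= linearB.
  have := congr1 (fun h : {linear _ -> _} => h w)
    (nt_natural p (gen W : @hom Tq W W)).
  by rewrite eK /= => ->; rewrite subrr.
have dV x : (i V : {linear _ -> _}) ((u V : {linear _ -> _}) x) =
    (fmap H (gen V : @hom Tq V V) : {linear _ -> _}) x - x.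
  by rewrite -[RHS]/((d V : {linear _ -> _}) x) -iu.
set g : {linear _ -> _} := fmap H _ in dV *.
have gi x : g ((i V : {linear _ -> _}) x) = (i V : {linear _ -> _}) x.
  have := congr1 (fun h : {linear _ -> _} => h x)
    (nt_natural i (gen V : @hom Tq V V)).
  by rewrite eG.
have gg x : g (g x) = g x.
  have := congr1 (fun h : {linear _ -> _} => h x)
    (fmap_comp H (gen V : @hom Tq V V) (gen V)).
  by rewrite [comp _ _]gen_idem.
(* $H(e)$ fixes $iu(v)=H(e)v-v$ by [gi] and kills it by [gg]. *)
have := gi ((u V : {linear _ -> _}) v).
by rewrite dV linearB gg subrr => /esym/eqP; rewrite subr_eq0 => /eqP.
Qed.
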